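(* Let $\mathcal{A}$ be the reflection equation algebra for $n=3$ associated with the Drinfeld $R$-matrix, with generating matrix $$L=\begin{pmatrix} l_1 & a^+ & c^+\\ a^- & l_2 & b^+\\ c^- & b^- & l_3\end{pmatrix},$$ and let $\mathcal{A}_{loc}$ be its localization in which $c^+$ and $l_2-b^+(c^+)^{-1}a^+$ are inverted. Define in $\mathcal{A}_{loc}$ the quasi-determinants $$I_1=c^+,\qquad I_2=l_2-b^+(c^+)^{-1}a^+,\qquad I_3=c^- -(b^-,\,l_3)\begin{pmatrix} a^+ & c^+\\ l_2 & b^+\end{pmatrix}^{-1}\begin{pmatrix} l_1\\ a^-\end{pmatrix}.$$ Then $I_1,I_2,I_3$ pairwise commute in $\mathcal{A}_{loc}$: $I_iI_j=I_jI_i$ for all $i,j\in\{1,2,3\}$.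
   Context: The ground field is $\mathbb{C}$ and $q\in\mathbb{C}\setminus\{0\}$. The Drinfeld $R$-matrix for $n=3$ is $$R=\sum_{1\le i<j\le 3}(q-q^{-1})E_{ii}\otimes E_{jj}+\sum_{i,j=1}^{3}q^{\delta_{ij}}E_{ij}\otimes E_{ji}\in Mat_{3\times3}^{\otimes 2},$$ where $E_{ij}$ are the matrix units. The reflection equation algebra $\mathcal{A}$ is the unital associative algebra with nine generators $a_{ij}$ ($1\le i,j\le 3$) and the quadratic relations given by the entries of $$RL_1RL_1=L_1RL_1R \quad\text{in } Mat_{3\times 3}^{\otimes 2}\otimes\mathcal{A},$$ where $L=\sum_{i,j} E_{ij}\otimes a_{ij}$, $L_1=\sum_{i,j} E_{ij}\otimes 1\otimes a_{ij}$, and $R$ stands for $R\otimes 1$. The generators are renamed $a_{11}=l_1$, $a_{22}=l_2$, $a_{33}=l_3$, $a_{12}=a^+$, $a_{13}=c^+$, $a_{23}=b^+$, $a_{21}=a^-$, $a_{31}=c^-$, $a_{32}=b^-$. $\mathcal{A}_{loc}$ is the universal localization of $\mathcal{A}$ obtained by adjoining a two-sided inverse of $c^+$ and then a two-sided inverse of $l_2-b^+(c^+)^{-1}a^+$; generators denote their images in it. Since $c^+$ and this Schur complement are invertible in $\mathcal{A}_{loc}$, the matrix $\begin{pmatrix} a^+ & c^+\\ l_2 & b^+\end{pmatrix}$ is invertible over $\mathcal{A}_{loc}$, so $I_3$ is defined. *)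

(* Defs.v *)
From HB Require Import structures.
From mathcomp Require Import all_boot all_order all_algebra.
From mathcomp Require Import boolp reals.
From mathcomp.real_closed Require Import complex mxtens.
From mathcomp Require Import monalg.

Set Implicit Arguments.
Unset Strict Implicit.
Unset Printing Implicit Defensive.
Import GRing.Theory.
Local Open Scope ring_scope.
Local Open Scope quotient_scope.

Inductive tideal (B : pzRingType) (S : B -> Prop) : B -> Prop :=
| tideal_gen x : S x -> tideal S x
| tideal_0 : tideal S 0
| tideal_add x y : tideal S x -> tideal S y -> tideal S (x + y)
| tideal_mull a x : tideal S x -> tideal S (a * x)
| tideal_mulr a x : tideal S x -> tideal S (x * a).

Section TwoSidedQuotient.
Variables (B : pzRingType) (S : B -> Prop).

Definition tideal_pred : {pred B} := [pred x | `[< tideal S x >]].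

Lemma tideal_predP x : reflect (tideal S x) (x \in tideal_pred).
Proof. exact: asboolP. Qed.

Lemma tideal_zmod_closed : zmod_closed tideal_pred.
Proof.
split=> [|x y /tideal_predP Ix /tideal_predP Iy].
  by apply/tideal_predP; exact: tideal_0.
by apply/tideal_predP/tideal_add; rewrite // -mulN1r; exact: tideal_mull.
Qed.
HB.instance Definition _ := GRing.isZmodClosed.Build B tideal_pred
  tideal_zmod_closed.

(* The quotient may be the zero ring, so only a pzRingType is available. *)
Definition tquot := Quotient.quot tideal_pred.
HB.instance Definition _ := GRing.Zmodule.on tquot.

Definition tquot_pi (x : B) : tquot := \pi x.
Definition tquot_mul (x y : tquot) := tquot_pi (repr x * repr y).

Lemma tquot_piP x y : tquot_pi x = tquot_pi y <-> tideal S (x - y).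
Proof.
split=> [/eqP|/tideal_predP Ixy].
  by rewrite -Quotient.idealrBE => /tideal_predP.
by apply/eqP; rewrite -Quotient.idealrBE.
Qed.

Lemma tquot_repr x : tquot_pi (repr x) = x.
Proof. exact: reprK. Qed.

Lemma tquot_mulE x y : tquot_mul (tquot_pi x) (tquot_pi y) = tquot_pi (x * y).
Proof.
apply/tquot_piP; set x' := repr _; set y' := repr _.
have -> : x' * y' - x * y = (x' - x) * y' + x * (y' - y).
  by rewrite mulrBl mulrBr addrA subrK.
apply: tideal_add.
  by apply: tideal_mulr; apply/tquot_piP; rewrite tquot_repr.
by apply: tideal_mull; apply/tquot_piP; rewrite tquot_repr.
Qed.

Lemma tquot_pi_is_zmod : zmod_morphism tquot_pi.
Proof. by move=> x y; rewrite /tquot_pi !piE. Qed.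
HB.instance Definition _ :=
  GRing.isZmodMorphism.Build B tquot tquot_pi tquot_pi_is_zmod.

Lemma tquot_mulA : associative tquot_mul.
Proof.
move=> x y z; rewrite -[x]tquot_repr -[y]tquot_repr -[z]tquot_repr.
by rewrite !tquot_mulE mulrA.
Qed.

Lemma tquot_mul1q : left_id (tquot_pi 1) tquot_mul.
Proof. by move=> x; rewrite -[x]tquot_repr tquot_mulE mul1r. Qed.

Lemma tquot_mulq1 : right_id (tquot_pi 1) tquot_mul.
Proof. by move=> x; rewrite -[x]tquot_repr tquot_mulE mulr1. Qed.

Lemma tquot_mulDl : left_distributive tquot_mul +%R.
Proof.
move=> x y z; rewrite -[x]tquot_repr -[y]tquot_repr -[z]tquot_repr.
by rewrite -raddfD !tquot_mulE mulrDl raddfD.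
Qed.

Lemma tquot_mulDr : right_distributive tquot_mul +%R.
Proof.
move=> x y z; rewrite -[x]tquot_repr -[y]tquot_repr -[z]tquot_repr.
by rewrite -raddfD !tquot_mulE mulrDr raddfD.
Qed.

HB.instance Definition _ := GRing.Zmodule_isPzRing.Build tquot
  tquot_mulA tquot_mul1q tquot_mulq1 tquot_mulDl tquot_mulDr.

Lemma tquot_pi_is_monoid : monoid_morphism tquot_pi.
Proof. by split=> // x y; rewrite -tquot_mulE. Qed.
HB.instance Definition _ :=
  GRing.isMonoidMorphism.Build B tquot tquot_pi tquot_pi_is_monoid.

Lemma tquot_pi_rel x : S x -> tquot_pi x = 0.
Proof.
move=> Sx; rewrite -(raddf0 tquot_pi); apply/tquot_piP.
by rewrite subr0; exact: tideal_gen.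
Qed.

Lemma tquot_pi1 : tquot_pi 1 = 1.
Proof. by []. Qed.

Lemma tquot_piM x y : tquot_pi (x * y) = tquot_pi x * tquot_pi y.
Proof. exact: rmorphM. Qed.

Lemma tquot_piD x y : tquot_pi (x + y) = tquot_pi x + tquot_pi y.
Proof. exact: raddfD. Qed.

Lemma tquot_pi_eq x y : S (x - y) -> tquot_pi x = tquot_pi y.
Proof. by move=> Sxy; apply/tquot_piP; exact: tideal_gen. Qed.

End TwoSidedQuotient.

(* Universal localization of the ring B at x. The free ring on the set B      *)
(* together with one more letter t = None is divided by the relations that    *)
(* make B -> loc x a ring morphism and t a two-sided inverse of the image     *)
(* of x. If B is an algebra over a field then so is loc x: scalars are        *)
(* central in B, hence commute with the image of x and with its inverse, so   *)
(* adjoining the inverse in rings or in algebras is the same thing.           *)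
Section Localization.
Variables (B : pzRingType) (x : B).

Let F := {malg int[{fmonom (option B)}]}.
Let letter (o : option B) : F := mkmalgU (fmu o) 1.

Inductive loc_rel : F -> Prop :=
| loc_relD a b : loc_rel (letter (Some (a + b))
                          - (letter (Some a) + letter (Some b)))
| loc_relM a b : loc_rel (letter (Some (a * b))
                          - letter (Some a) * letter (Some b))
| loc_rel1 : loc_rel (letter (Some 1) - 1)
| loc_relVr : loc_rel (letter (Some x) * letter None - 1)
| loc_relVl : loc_rel (letter None * letter (Some x) - 1).

Definition loc := tquot loc_rel.
HB.instance Definition _ := GRing.PzRing.on loc.

Definition loc_map (a : B) : loc := tquot_pi loc_rel (letter (Some a)).
Definition loc_inv : loc := tquot_pi loc_rel (letter None).

Lemma loc_map_is_zmod : zmod_morphism loc_map.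
Proof.
have mapD a b : loc_map (a + b) = loc_map a + loc_map b.
  exact: etrans (tquot_pi_eq (loc_relD a b)) (tquot_piD _ _ _).
by move=> a b; apply/eqP; rewrite eq_sym subr_eq -mapD subrK.
Qed.
HB.instance Definition _ :=
  GRing.isZmodMorphism.Build B loc loc_map loc_map_is_zmod.

Lemma loc_map_is_monoid : monoid_morphism loc_map.
Proof.
split=> [|a b].
  exact: etrans (tquot_pi_eq loc_rel1) (tquot_pi1 _).
exact: etrans (tquot_pi_eq (loc_relM a b)) (tquot_piM _ _ _).
Qed.
HB.instance Definition _ :=
  GRing.isMonoidMorphism.Build B loc loc_map loc_map_is_monoid.

Lemma loc_mulxV : loc_map x * loc_inv = 1.
Proof.
exact: etrans (esym (tquot_piM _ _ _))
  (etrans (tquot_pi_eq loc_relVr) (tquot_pi1 _)).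
Qed.

Lemma loc_mulVx : loc_inv * loc_map x = 1.
Proof.
exact: etrans (esym (tquot_piM _ _ _))
  (etrans (tquot_pi_eq loc_relVl) (tquot_pi1 _)).
Qed.

End Localization.

(* invmx requires commutative entries. *)
Section NoncommutativeInverse.
Variables (B : pzRingType) (n : nat).
Implicit Types M N : 'M[B]_n.

Definition is_invmx M N := M *m N = 1%:M /\ N *m M = 1%:M.

Definition ncinvmx M : 'M[B]_n :=
  if pselect (exists N, is_invmx M N) is left exN then projT1 (cid exN) else 0.

Lemma ncinvmxP M N : is_invmx M N -> ncinvmx M = N.
Proof.
move=> [MN NM]; rewrite /ncinvmx; case: pselect => [exN|[]]; last by exists N.
case: cid => N' [MN' N'M] /=.
by rewrite -[N']mulmx1 -MN mulmxA N'M mul1mx.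
Qed.

End NoncommutativeInverse.

Definition o1 : 'I_3 := @Ordinal 3 0 isT.
Definition o2 : 'I_3 := @Ordinal 3 1 isT.
Definition o3 : 'I_3 := @Ordinal 3 2 isT.

(* R L_1 R L_1 - L_1 R L_1 R, where the Kronecker product *t identifies       *)
(* Mat_3 (x) Mat_3 with Mat_9.                                                *)
Definition reflection (B : pzRingType) (R : 'M[B]_(3 * 3)) (L : 'M[B]_3) :
    'M[B]_(3 * 3) :=
  let L1 := L *t (1%:M : 'M_3) in
  R *m L1 *m R *m L1 - L1 *m R *m L1 *m R.

Lemma map_reflection (A B : pzRingType) (f : {rmorphism A -> B}) R L :
  map_mx f (reflection R L) = reflection (map_mx f R) (map_mx f L).
Proof. by rewrite /reflection map_mxB !map_mxM !map_mxT !map_mx1. Qed.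

(* cpV stands for the inverse of c^+ = L o1 o3. *)
Section QuasiDeterminants.
Variables (B : pzRingType) (L : 'M[B]_3) (cpV : B).

Local Notation l1 := (L o1 o1).
Local Notation l2 := (L o2 o2).
Local Notation l3 := (L o3 o3).
Local Notation ap := (L o1 o2).
Local Notation cp := (L o1 o3).
Local Notation bp := (L o2 o3).
Local Notation am := (L o2 o1).
Local Notation cm := (L o3 o1).
Local Notation bm := (L o3 o2).

Definition qdet1 : B := cp.

Definition qdet2 : B := l2 - bp * cpV * ap.

Definition qdet3_mx : 'M[B]_(1 + 1) :=
  block_mx ap%:M cp%:M
           l2%:M bp%:M.

Definition qdet3 : B :=
  cm - (row_mx bm%:M l3%:M *m ncinvmx qdet3_mx *m col_mx l1%:M am%:M)
         (ord0 : 'I_1) (ord0 : 'I_1).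

Lemma qdet3_mx_inv s :
    cp * cpV = 1 -> cpV * cp = 1 -> qdet2 * s = 1 -> s * qdet2 = 1 ->
  is_invmx qdet3_mx
    (block_mx (- (s * bp * cpV))%:M s%:M
              (cpV + cpV * ap * s * bp * cpV)%:M (- (cpV * ap * s))%:M).
Proof.
move=> cV Vc dV Vd.
have El2 : l2 = qdet2 + bp * cpV * ap by rewrite subrK.
have cK u : cp * (cpV * u) = u by rewrite mulrA cV mul1r.
have dK u : qdet2 * (s * u) = u by rewrite mulrA dV mul1r.
split; rewrite mulmx_block -!scalar_mxM -!raddfD El2 /= scalar_mx_block.
- congr block_mx; rewrite -?(raddf0 (@scalar_mx B 1)); congr (_%:M).
  + by rewrite mulrDr mulrN -!mulrA !cK cV addrCA addNr addr0.
  + by rewrite mulrN -!mulrA !cK subrr.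
  + rewrite mulrDl mulrDr !mulrN -!mulrA dK.
    by rewrite -opprD addNr.
  + by rewrite mulrDl mulrN -!mulrA dV addrK.
- congr block_mx; rewrite -?(raddf0 (@scalar_mx B 1)); congr (_%:M).
  + by rewrite mulNr mulrDr Vd -!mulrA addrC addrK.
  + by rewrite mulNr -!mulrA Vc mulr1 addNr.
  + rewrite mulNr mulrDr mulrDl -[_ * s * qdet2]mulrA Vd mulr1.
    by rewrite !mulrA subrr.
  + by rewrite mulNr mulrDl -!mulrA Vc mulr1 addrK.
Qed.

End QuasiDeterminants.

Lemma map_qdet2 (A B : pzRingType) (f : {rmorphism A -> B}) L cpV :
  f (qdet2 L cpV) = qdet2 (map_mx f L) (f cpV).
Proof. by rewrite /qdet2 rmorphB !rmorphM !mxE. Qed.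

Section ReflectionEquationAlgebra.
Variables (F : fieldType) (q : F).

Definition drinfeldR : 'M[F]_(3 * 3) :=
  \sum_(i < 3) \sum_(j < 3 | (i < j)%N)
     (q - q^-1) *: (delta_mx i i *t delta_mx j j)
  + \sum_(i < 3) \sum_(j < 3)
     q ^+ (i == j) *: (delta_mx i j *t delta_mx j i).

Definition free_rea := {malg F[{fmonom ('I_3 * 'I_3)%type}]}.
HB.instance Definition _ := GRing.Lalgebra.on free_rea.

Definition freeL : 'M[free_rea]_3 := \matrix_(i, j) mkmalgU (fmu (i, j)) 1.

Definition free_reflection : 'M[free_rea]_(3 * 3) :=
  reflection (map_mx (in_alg free_rea) drinfeldR) freeL.

Definition rea_rel (x : free_rea) : Prop := exists i j, x = free_reflection i j.

Definition rea := tquot rea_rel.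
HB.instance Definition _ := GRing.PzRing.on rea.

Definition rea_scalar (c : F) : rea := tquot_pi rea_rel (in_alg free_rea c).
Definition reaL : 'M[rea]_3 := map_mx (tquot_pi rea_rel) freeL.

(* Adjoin the inverse of c^+, then that of l_2 - b^+ (c^+)^{-1} a^+. *)
Definition rea_loc1 := loc (reaL o1 o3).
HB.instance Definition _ := GRing.PzRing.on rea_loc1.

Definition schur : rea_loc1 :=
  qdet2 (map_mx (loc_map (reaL o1 o3)) reaL) (loc_inv (reaL o1 o3)).

Definition rea_loc := loc schur.
HB.instance Definition _ := GRing.PzRing.on rea_loc.

Definition locL : 'M[rea_loc]_3 :=
  map_mx (loc_map schur) (map_mx (loc_map (reaL o1 o3)) reaL).

Definition loc_cpV : rea_loc := loc_map schur (loc_inv (reaL o1 o3)).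

Definition qdet (k : 'I_3) : rea_loc :=
  tnth [tuple qdet1 locL; qdet2 locL loc_cpV; qdet3 locL] k.

Lemma rea_reflection : reflection (map_mx rea_scalar drinfeldR) reaL = 0.
Proof.
rewrite (map_mx_comp (in_alg free_rea) (tquot_pi rea_rel)) -map_reflection.
apply/matrixP => i j.
by rewrite [LHS]mxE [RHS]mxE; apply: tquot_pi_rel; exists i, j.
Qed.

Lemma loc_cp_mulV : locL o1 o3 * loc_cpV = 1.
Proof.
rewrite [locL _ _]mxE [map_mx _ _ _ _]mxE.
apply: etrans (esym (rmorphM (loc_map schur) _ _)) _.
exact: etrans (congr1 _ (loc_mulxV _)) (rmorph1 (loc_map schur)).
Qed.

Lemma loc_cp_mulVl : loc_cpV * locL o1 o3 = 1.
Proof.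
rewrite [locL _ _]mxE [map_mx _ _ _ _]mxE.
apply: etrans (esym (rmorphM (loc_map schur) _ _)) _.
exact: etrans (congr1 _ (loc_mulVx _)) (rmorph1 (loc_map schur)).
Qed.

Lemma loc_qdet2E : qdet2 locL loc_cpV = loc_map schur schur.
Proof. by rewrite [in RHS]/schur map_qdet2. Qed.

Lemma loc_qdet2_mulV : qdet2 locL loc_cpV * loc_inv schur = 1.
Proof. by rewrite loc_qdet2E; exact: loc_mulxV. Qed.

Lemma loc_qdet2_mulVl : loc_inv schur * qdet2 locL loc_cpV = 1.
Proof. by rewrite loc_qdet2E; exact: loc_mulVx. Qed.

Lemma loc_qdet3_mx_inv : is_invmx (qdet3_mx locL) (ncinvmx (qdet3_mx locL)).
Proof.
have inv := qdet3_mx_inv loc_cp_mulV loc_cp_mulVl loc_qdet2_mulV loc_qdet2_mulVl.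
by rewrite (ncinvmxP inv).
Qed.

End ReflectionEquationAlgebra.

(* Main.v *)
(* Write s for the inverse of c^+ and let d, m, n, k be the entries of the     *)
(* Schur complement of c^+ in L:                                              *)
(*   d = l_2 - b^+ s a^+ = I_2,   m = a^- - b^+ s l_1,                        *)
(*   n = b^- - l_3 s a^+,         k = c^- - l_3 s l_1.                        *)
(* Then I_3 = k - n d^-1 m. With p = q^-1 and h = 1 - p^2, the reflection     *)
(* equation gives                                                             *)
(*   c^+ d = d c^+,                c^+ m = q m c^+,                           *)
(*   c^+ n = p n c^+ - h a^+ d,    c^+ k = k c^+ - h a^+ m,                   *)
(*   m d = d m,                    d n = q^2 n d + (q^2 - 1) d^2 s a^+,       *)
(*   d k = k d + (q^2 - 1) (n m + d s a^+ m),                                 *)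
(* and d commutes with s and a^+. In c^+ I_3 and in d I_3 the inhomogeneous   *)
(* terms cancel, which leaves I_3 c^+ and I_3 d.                              *)

Require Import Defs.
From mathcomp Require Import all_boot all_order all_algebra.
From mathcomp Require Import reals.
From mathcomp.real_closed Require Import complex mxtens.
From mathcomp Require Import monalg.
Set Implicit Arguments.
Unset Strict Implicit.
Unset Printing Implicit Defensive.
Import GRing.Theory.
Local Open Scope ring_scope.
Local Open Scope complex_scope.

(** * Rewriting in noncommutative rings *)

(** The reflection equation compares the squares of [R L_1] and [L_1 R], so each of its entries is a
    quadratic exchange rule between generators. Multiplying by the inverse [s] of [c^+] yields rules
    for [s] as well. Sorting both sides of each relation displayed above with these rules proves it
    ([cp_d] to [d_k]); the sorting is computation, justified by [nc_checkP].

    Let [t] be the inverse of [d], so that [I_3 = k - n t m] ([qdet3E]). When [c^+] passes through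
    [n t m], the factor [p] from [n] cancels the factor [q] from [m], and the extra term
    [- h a^+ d t m = - h a^+ m] is exactly the one produced by [k]. When [d] passes through, [n t m]
    gives [q^2 n m], of which [k] removes [(q^2 - 1) n m]; what remains is [n m = n t m d], because
    [m] commutes with [d]. The terms [d s a^+ m] cancel because [d] commutes with [s] and [a^+].
    [qdet_commute] carries this out in any ring with central scalars, and the theorem is its
    instance in the localization. *)

Inductive nc_expr :=
| NcVar of nat
| NcZero
| NcOne
| NcAdd of nc_expr & nc_expr
| NcOpp of nc_expr
| NcMul of nc_expr & nc_expr.

(** Coefficients are integers only: [q] and its inverse are treated as letters, and their centrality
    enters through rewriting rules. *)
Definition nc_poly := seq (int * seq nat).
Definition nc_rule := (seq nat * nc_poly)%type.

Fixpoint nc_addm (x : int * seq nat) (p : nc_poly) : nc_poly :=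
  if p is y :: p' then
    if x.2 == y.2 then (x.1 + y.1, y.2) :: p' else y :: nc_addm x p'
  else [:: x].

Definition nc_scale (c : int) (p : nc_poly) : nc_poly :=
  [seq (c * x.1, x.2) | x <- p].

Definition nc_mul (p r : nc_poly) : nc_poly :=
  [seq (x.1 * y.1, x.2 ++ y.2) | x <- p, y <- r].

Fixpoint nc_expand (e : nc_expr) : nc_poly :=
  match e with
  | NcVar i => [:: (1, [:: i])]
  | NcZero => [::]
  | NcOne => [:: (1, [::])]
  | NcAdd e1 e2 => nc_expand e1 ++ nc_expand e2
  | NcOpp e1 => nc_scale (-1) (nc_expand e1)
  | NcMul e1 e2 => nc_mul (nc_expand e1) (nc_expand e2)
  end.

Fixpoint nc_head (rs : seq nc_rule) (w : seq nat) : option nc_poly :=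
  if rs is r :: rs' then
    if take (size r.1) w == r.1 then
      Some [seq (x.1, x.2 ++ drop (size r.1) w) | x <- r.2]
    else nc_head rs' w
  else None.

Fixpoint nc_step (rs : seq nc_rule) (w : seq nat) : option nc_poly :=
  if nc_head rs w is Some p then Some p
  else if w is i :: w' then
    omap (map (fun x : int * seq nat => (x.1, i :: x.2))) (nc_step rs w')
  else None.

(** Every exit, including exhausted fuel, returns terms with the same sum, so soundness requires
    neither termination nor confluence of the rules. *)
Fixpoint nc_nf (rs : seq nc_rule) (fuel : nat) (p acc : nc_poly) : nc_poly :=
  match fuel, p with
  | fuel'.+1, x :: p' =>
    if nc_step rs x.2 is Some r then
      nc_nf rs fuel' (foldr nc_addm p' (nc_scale x.1 r)) acc
    else nc_nf rs fuel' p' (nc_addm x acc)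
  | _, _ => p ++ acc
  end.

(* An equation is used from left to right when its left-hand side is a word,
   and is ignored otherwise. *)
Fixpoint nc_rules (es : seq (nc_expr * nc_expr)) : seq nc_rule :=
  if es is e :: es' then
    let p := nc_expand e.2 in
    if nc_expand e.1 is [:: (Posz 1, w)] then
      if p == [:: (1, w)] then nc_rules es' else (w, p) :: nc_rules es'
    else nc_rules es'
  else [::].

Definition nc_check (fuel : nat) (es : seq (nc_expr * nc_expr)) (e1 e2 : nc_expr) : bool :=
  all (fun x => x.1 == 0)
    (nc_nf (nc_rules es) fuel (nc_expand (NcAdd e1 (NcOpp e2))) [::]).

Section NcEval.
Variables (B : pzRingType) (env : seq B).

Fixpoint nc_eval (e : nc_expr) : B :=
  match e with
  | NcVar i => env`_i
  | NcZero => 0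
  | NcOne => 1
  | NcAdd e1 e2 => nc_eval e1 + nc_eval e2
  | NcOpp e1 => - nc_eval e1
  | NcMul e1 e2 => nc_eval e1 * nc_eval e2
  end.

Fixpoint nc_eqs (es : seq (nc_expr * nc_expr)) : Prop :=
  if es is e :: es' then nc_eval e.1 = nc_eval e.2 /\ nc_eqs es' else True.

Definition nc_word (w : seq nat) : B := \prod_(i <- w) env`_i.
Definition nc_sum (p : nc_poly) : B := \sum_(x <- p) x.1%:~R * nc_word x.2.

Lemma nc_word_cat u v : nc_word (u ++ v) = nc_word u * nc_word v.
Proof. exact: big_cat. Qed.

Lemma nc_sum_cat p r : nc_sum (p ++ r) = nc_sum p + nc_sum r.
Proof. exact: big_cat. Qed.

Lemma nc_sum_cons x p : nc_sum (x :: p) = x.1%:~R * nc_word x.2 + nc_sum p.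
Proof. exact: big_cons. Qed.

Lemma nc_sum_addm x p : nc_sum (nc_addm x p) = x.1%:~R * nc_word x.2 + nc_sum p.
Proof.
elim: p => [|y p IHp] /=; first by rewrite nc_sum_cons.
case: eqP => [->|_]; last by rewrite !nc_sum_cons IHp addrCA.
by rewrite !nc_sum_cons /= rmorphD mulrDl addrA.
Qed.

Lemma nc_sum_foldr p r : nc_sum (foldr nc_addm r p) = nc_sum p + nc_sum r.
Proof.
elim: p => [|x p IHp] /=; first by rewrite /nc_sum big_nil add0r.
by rewrite nc_sum_addm IHp nc_sum_cons addrA.
Qed.

Lemma nc_sum_scale c p : nc_sum (nc_scale c p) = c%:~R * nc_sum p.
Proof.
rewrite /nc_sum big_map mulr_sumr.
by apply: eq_bigr => x _; rewrite /= rmorphM mulrA.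
Qed.

Lemma nc_sum_mul p r : nc_sum (nc_mul p r) = nc_sum p * nc_sum r.
Proof.
rewrite /nc_sum big_allpairs_dep mulr_suml; apply: eq_bigr => x _.
rewrite mulr_sumr; apply: eq_bigr => y _.
rewrite /= nc_word_cat rmorphM -!mulrA; congr (_ * _).
by rewrite !mulrA; congr (_ * _); symmetry; exact: commr_int.
Qed.

Lemma nc_expandP e : nc_sum (nc_expand e) = nc_eval e.
Proof.
elim: e => [i|||e1 IH1 e2 IH2|e1 IH1|e1 IH1 e2 IH2] /=.
- by rewrite /nc_sum big_seq1 /nc_word big_seq1 mul1r.
- exact: big_nil.
- by rewrite /nc_sum big_seq1 /nc_word big_nil mul1r.
- by rewrite nc_sum_cat IH1 IH2.
- by rewrite nc_sum_scale IH1 mulN1r.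
- by rewrite nc_sum_mul IH1 IH2.
Qed.

Section Rewriting.
Variable rs : seq nc_rule.
Hypothesis rsP : forall r, r \in rs -> nc_word r.1 = nc_sum r.2.

Lemma nc_headP w p : nc_head rs w = Some p -> nc_word w = nc_sum p.
Proof.
elim: rs rsP => //= r rs' IHrs rP.
case: eqP => [def_r [<-]|_]; last first.
  by apply: IHrs => r' r'in; apply: rP; rewrite inE r'in orbT.
rewrite -{1}(cat_take_drop (size r.1) w) nc_word_cat def_r.
rewrite (rP r) ?mem_head // /nc_sum big_map mulr_suml.
by apply: eq_bigr => x _; rewrite /= nc_word_cat mulrA.
Qed.

Lemma nc_stepP w p : nc_step rs w = Some p -> nc_word w = nc_sum p.
Proof.
elim: w p => [|i w IHw] p /=.
  by case def_p: nc_head => [p'|//] [<-]; apply: nc_headP.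
case def_p: nc_head => [p'|]; first by case=> <-; apply: nc_headP.
case: nc_step IHw => //= r /(_ _ erefl) Ew [<-].
rewrite /nc_word big_cons -/(nc_word w) Ew /nc_sum big_map mulr_sumr.
apply: eq_bigr => x _ /=.
by rewrite /nc_word big_cons mulrA [_ * _%:~R]commr_int -mulrA.
Qed.

Lemma nc_nfP fuel p acc : nc_sum (nc_nf rs fuel p acc) = nc_sum p + nc_sum acc.
Proof.
elim: fuel p acc => [|fuel IH] p acc /=; first by rewrite nc_sum_cat.
case: p => [|x p]; first by rewrite -nc_sum_cat.
case def_r: nc_step => [r|]; rewrite IH.
  by rewrite nc_sum_foldr nc_sum_scale -(nc_stepP def_r) nc_sum_cons.
by rewrite nc_sum_addm nc_sum_cons addrCA addrA.
Qed.

End Rewriting.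

Lemma nc_rulesP es r :
  nc_eqs es -> r \in nc_rules es -> nc_word r.1 = nc_sum r.2.
Proof.
elim: es => [|[e1 e2] es IHes] //= [Ee /IHes{}IHes].
have := nc_expandP e1; rewrite Ee -nc_expandP.
case: (nc_expand e1) => [//|[[[|[|c]]|c] w] [|x p]] //= Ew.
case: ifP => // _; rewrite inE => /predU1P[->|//] /=.
by rewrite -Ew /nc_sum big_seq1 mul1r.
Qed.

Theorem nc_checkP fuel es e1 e2 :
  nc_eqs es -> nc_check fuel es e1 e2 -> nc_eval e1 = nc_eval e2.
Proof.
move=> esP /allP coef0; apply/eqP; rewrite -subr_eq0.
rewrite -[X in X == 0]/(nc_eval (NcAdd e1 (NcOpp e2))) -nc_expandP.
have := nc_nfP (fun r => nc_rulesP esP) fuel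
  (nc_expand (NcAdd e1 (NcOpp e2))) [::].
rewrite [nc_sum [::]]big_nil addr0 => <-.
rewrite /nc_sum big_seq big1 // => x /coef0 /eqP ->.
by rewrite mul0r.
Qed.

End NcEval.

(** * Reification of equations in a ring *)

Ltac nc_index x l :=
  lazymatch l with
  | cons x _ => constr:(0%N)
  | cons _ ?l' => let i := nc_index x l' in constr:(S i)
  end.

Ltac nc_insert x l :=
  lazymatch l with
  | context [cons x _] => l
  | @cons ?T ?y ?l' => let l'' := nc_insert x l' in constr:(@cons T y l'')
  | @nil ?T => constr:(@cons T x (@nil T))
  end.

Ltac nc_atoms t l :=
  lazymatch t with
  | 0%R => l
  | 1%R => l
  | @GRing.add _ ?x ?y => let l' := nc_atoms x l in nc_atoms y l'
  | @GRing.mul _ ?x ?y => let l' := nc_atoms x l in nc_atoms y l'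
  | @GRing.opp _ ?x => nc_atoms x l
  | _ => nc_insert t l
  end.

Ltac nc_reify t l :=
  lazymatch t with
  | 0%R => constr:(NcZero)
  | 1%R => constr:(NcOne)
  | @GRing.add _ ?x ?y =>
    let a := nc_reify x l in let b := nc_reify y l in constr:(NcAdd a b)
  | @GRing.mul _ ?x ?y =>
    let a := nc_reify x l in let b := nc_reify y l in constr:(NcMul a b)
  | @GRing.opp _ ?x => let a := nc_reify x l in constr:(NcOpp a)
  | _ => let i := nc_index t l in constr:(NcVar i)
  end.

Ltac nc_hyp_atoms hs l :=
  lazymatch hs with
  | (?hs', ?h) =>
    let l' := nc_hyp_atoms hs' l in nc_hyp_atoms h l'
  | _ =>
    lazymatch type of hs with
    | ?a = ?b => let l' := nc_atoms a l in nc_atoms b l'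
    | _ => l
    end
  end.

(* A hypothesis [forall x, _] is instantiated at every atom. *)
Ltac nc_inst h atoms l es prf k :=
  lazymatch atoms with
  | cons ?x ?atoms' =>
    nc_hyps (h x) l es prf
      ltac:(fun es' prf' => nc_inst h atoms' l es' prf' k)
  | nil => k es prf
  end
with nc_hyps hs l es prf k :=
  lazymatch hs with
  | (?hs', ?h) =>
    nc_hyps h l es prf ltac:(fun es' prf' => nc_hyps hs' l es' prf' k)
  | _ =>
    let T := type of hs in
    let T := eval cbv beta in T in
    lazymatch T with
    | ?a = ?b =>
      let ea := nc_reify a l in
      let eb := nc_reify b l in
      k (cons (ea, eb) es) (conj hs prf)
    | _ => nc_inst hs l l es prf k
    end
  end.

(* Failure of the check only shows at Qed. *)
Ltac ncring hs :=
  lazymatch goal with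
  | |- @eq ?T ?a ?b =>
    let l := nc_hyp_atoms hs (@nil T) in
    let l := nc_atoms a l in
    let l := nc_atoms b l in
    let ea := nc_reify a l in
    let eb := nc_reify b l in
    nc_hyps hs l (@nil (nc_expr * nc_expr)) I
      ltac:(fun es prf =>
        refine (@nc_checkP _ l 5000 es ea eb prf _); vm_cast_no_check (erefl true))
  end.

(** * Central scalars *)

(** Commuting with the letters propagates to words by induction, then to integer combinations of
    words. *)
Lemma fmonom_malg_comm (I : choiceType) (A : pzRingType)
    (g : {rmorphism {malg int[{fmonom I}]} -> A}) (z : A) :
  (forall i, GRing.comm z (g (mkmalgU (fmu i) 1))) -> forall u, GRing.comm z (g u).
Proof.
move=> zC; have wC (s : seq I) : GRing.comm z (g (mkmalgU (FMonom s) 1)).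
  elim: s => [|i s IHs].
    by rewrite -fmoneE; have := commr1 z; rewrite -(rmorph1 g).
  have -> : FMonom (i :: s) = mmul (fmu i) (FMonom s).
    by apply/eqP; rewrite fmP fmM fmU.
  rewrite -[X in mkmalgU _ X]mulr1 -fgmulUU -malgM_def rmorphM.
  exact: commrM.
move=> u; rewrite (monalgE u) raddf_sum; apply: commr_sum => w _.
by rewrite -[u@_w]intz !raddfMz -(fmK w); apply: commrMz; exact: wC.
Qed.

Lemma comm_inverse (A : pzRingType) (z u v : A) :
  u * v = 1 -> v * u = 1 -> GRing.comm z u -> GRing.comm z v.
Proof.
move=> uv vu zu; rewrite /GRing.comm -[LHS]mul1r -vu -mulrA [u * _]mulrA -zu.
by rewrite -!mulrA uv mulr1.
Qed.

(** The localization is a quotient of a free ring, so centrality is checked on letters: images of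
    [B], and the adjoined inverse, which is covered by [comm_inverse]. *)
Lemma loc_map_central (B : pzRingType) (x z : B) :
  (forall y, GRing.comm z y) -> forall y : loc x, GRing.comm (loc_map x z) y.
Proof.
move=> zC y; rewrite -[y]tquot_repr; apply: fmonom_malg_comm => -[b|].
  change (loc_map x z * loc_map x b = loc_map x b * loc_map x z).
  by rewrite -!rmorphM zC.
apply: comm_inverse (loc_mulxV x) (loc_mulVx x) _.
by rewrite /GRing.comm -!rmorphM zC.
Qed.

Lemma malg_scalar_comm (F : comNzRingType) (K : monomType) (c : F)
    (g : {malg F[K]}) : GRing.comm (in_alg _ c) g.
Proof.
rewrite /GRing.comm in_algE -mul_malgC mulr1 (monalgE g) mulr_sumr mulr_suml.
by apply: eq_bigr => k _; rewrite !malgM_def !fgmulUU mulrC mul1m mulm1.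
Qed.

Lemma tquot_pi_central (B : pzRingType) (S : B -> Prop) (z : B) :
  (forall y, GRing.comm z y) -> forall y : tquot S, GRing.comm (tquot_pi S z) y.
Proof. by move=> zC y; rewrite -[y]tquot_repr /GRing.comm -!tquot_piM zC. Qed.

Lemma rea_scalar_central (F : fieldType) (q c : F) (y : rea q) :
  GRing.comm (rea_scalar q c) y.
Proof.
exact: tquot_pi_central (malg_scalar_comm c) y.
Qed.

(** * Entries of the reflection equation *)

Lemma sum_I3 (V : nmodType) (F : 'I_3 -> V) :
  \sum_i F i = F o1 + F o2 + F o3.
Proof.
rewrite !big_ord_recr big_ord0 /= add0r.
by congr (F _ + F _ + F _); apply: val_inj.
Qed.

Lemma mulmx_tensE (A : pzRingType) m n p r (M : 'M[A]_(m, n * p))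
    (N : 'M[A]_(n * p, r)) i j :
  (M *m N) i j =
    \sum_k \sum_l M i (mxtens_index (k, l)) * N (mxtens_index (k, l)) j.
Proof.
rewrite mxE pair_big /= (reindex (@mxtens_index n p)) /=.
  by apply: eq_bigr => -[k l].
by exists (@mxtens_unindex n p) => k _; rewrite (mxtens_indexK, mxtens_unindexK).
Qed.

Lemma drinfeldRE (F : fieldType) (q : F) i b j c :
  drinfeldR q (mxtens_index (i, b)) (mxtens_index (j, c)) =
    (if (i == c) && (b == j) then if i == b then q else 1 else 0)
    + (if [&& i == j, b == c & (i < b)%N] then q - q^-1 else 0).
Proof.
rewrite /drinfeldR mxE !summxE addrC; congr (_ + _).
  rewrite (bigD1 i) //= summxE (bigD1 j) //= big1 => [|j' nj]; last first.
    by rewrite mxE tensmxE !mxE [j == j']eq_sym (negPf nj) andbF !mul0r mulr0.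
  rewrite addr0 big1 ?addr0 => [|i' ni]; last first.
    rewrite summxE big1 // => j' _.
    by rewrite mxE tensmxE !mxE [i == i']eq_sym (negPf ni) !mul0r mulr0.
  rewrite mxE tensmxE !mxE !eqxx mul1r [c == i]eq_sym andbC.
  case: (i == c); last by rewrite mulr0.
  by case: (b =P j) => [->|_]; rewrite ?mulr0 // mulr1; case: eqP.

rewrite (bigD1 i) //= summxE [X in _ + X]big1 ?addr0 => [|i' ni]; last first.
  rewrite summxE big1 // => j' _.
  by rewrite mxE tensmxE !mxE [i == i']eq_sym (negPf ni) !mul0r mulr0.
case: (ltnP i b) => [ltib|leib]; last first.
  rewrite !andbF big1 // => j' ltij; rewrite mxE tensmxE !mxE.
  case: (b =P j') leib => [->|_ _]; first by rewrite leqNgt ltij.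
  by rewrite mulr0 mulr0.
rewrite (bigD1 b) //= big1 ?addr0 => [|j' /andP[_ nj]]; last first.
  by rewrite mxE tensmxE !mxE [b == j']eq_sym (negPf nj) mulr0 mulr0.
rewrite mxE tensmxE !mxE !eqxx [j == i]eq_sym [c == b]eq_sym andbT /=.
by case: (i == j); case: (b == c); rewrite /= !(mulr0, mul0r, mulr1).
Qed.

Section ReflectionEquation.
Variables (F : fieldType) (q : F) (B : pzRingType) (f : {rmorphism F -> B}).
Variable L : 'M[B]_3.
Local Notation R := (map_mx f (drinfeldR q)).
Local Notation L1 := (L *t (1%:M : 'M[B]_3)).

(** Row [(i, b)] and column [(j, c)]. As [L_1] is the identity on the second tensor factor, the flip
    part and the diagonal part of [R] contribute at most one term each. *)
Definition RL_entry (i b j c : 'I_3) : B :=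
  (if i == c then (if i == b then f q else 1) * L b j else 0)
  + (if (b == c) && (i < b)%N then (f q - f q^-1) * L i j else 0).

Definition LR_entry (i b j c : 'I_3) : B :=
  (if b == j then L i c * (if j == c then f q else 1) else 0)
  + (if (b == c) && (j < c)%N then L i j * (f q - f q^-1) else 0).

Lemma RLE i b j c :
  (R *m L1) (mxtens_index (i, b)) (mxtens_index (j, c)) = RL_entry i b j c.
Proof.
transitivity (\sum_k R (mxtens_index (i, b)) (mxtens_index (k, c)) * L k j).
  rewrite mulmx_tensE; apply: eq_bigr => k _.
  rewrite (bigD1 c) //= big1 ?addr0 => [|l nl]; rewrite tensmxE !mxE.
    by rewrite eqxx mulr1.
  by rewrite (negPf nl) !mulr0.
under eq_bigr do rewrite mxE drinfeldRE rmorphD mulrDl.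
rewrite big_split /=; congr (_ + _).
  rewrite (bigD1 b) //= big1 ?addr0 => [|k nk].
    rewrite eqxx andbT; case: (i == c); last by rewrite rmorph0 mul0r.
    by rewrite [f _]fun_if rmorph1.
  by rewrite [b == k]eq_sym (negPf nk) andbF rmorph0 mul0r.
rewrite (bigD1 i) //= big1 ?addr0 => [|k nk].
  by rewrite eqxx /=; case: ifP => _; rewrite ?rmorphB ?rmorph0 ?mul0r.
by rewrite [i == k]eq_sym (negPf nk) rmorph0 mul0r.
Qed.

Lemma LRE i b j c :
  (L1 *m R) (mxtens_index (i, b)) (mxtens_index (j, c)) = LR_entry i b j c.
Proof.
transitivity (\sum_k L i k * R (mxtens_index (k, b)) (mxtens_index (j, c))).
  rewrite mulmx_tensE; apply: eq_bigr => k _.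
  rewrite (bigD1 b) //= big1 ?addr0 => [|l nl]; rewrite tensmxE !mxE.
    by rewrite eqxx mulr1.
  by rewrite [b == l]eq_sym (negPf nl) mulr0 mul0r.
under eq_bigr do rewrite mxE drinfeldRE rmorphD mulrDr.
rewrite big_split /=; congr (_ + _).
  rewrite (bigD1 c) //= big1 ?addr0 => [|k nk].
    rewrite eqxx /=; case: eqP => [->|_]; last by rewrite rmorph0 mulr0.
    by rewrite [f _]fun_if rmorph1 eq_sym.
  by rewrite (negPf nk) rmorph0 mulr0.
rewrite (bigD1 j) //= big1 ?addr0 => [|k nk].
  rewrite eqxx /=; case: eqP => [->|_] /=; last by rewrite rmorph0 mulr0.
  by case: ifP => _; rewrite ?rmorphB ?rmorph0 ?mulr0.
by rewrite (negPf nk) rmorph0 mulr0.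
Qed.

Lemma reflectionE i b j c :
  reflection R L (mxtens_index (i, b)) (mxtens_index (j, c)) =
    (\sum_k \sum_l RL_entry i b k l * RL_entry k l j c)
    - (\sum_k \sum_l LR_entry i b k l * LR_entry k l j c).
Proof.
rewrite /reflection -mulmxA -[X in _ - X]mulmxA mxE [X in _ + X]mxE !mulmx_tensE.
congr (_ - _); apply: eq_bigr => k _; apply: eq_bigr => l _.
  by rewrite !RLE.
by rewrite !LRE.
Qed.

Hypothesis q_neq0 : q != 0.
Hypothesis f_central : forall c x, GRing.comm (f c) x.
Hypothesis reflection0 : reflection R L = 0.

Local Notation q1 := (f q).
Local Notation p := (f q^-1).
Local Notation w := (q1 - p).
Local Notation h := (1 - p * p).
Local Notation l1 := (L o1 o1).
Local Notation l2 := (L o2 o2).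
Local Notation l3 := (L o3 o3).
Local Notation ap := (L o1 o2).
Local Notation cp := (L o1 o3).
Local Notation bp := (L o2 o3).
Local Notation am := (L o2 o1).
Local Notation cm := (L o3 o1).
Local Notation bm := (L o3 o2).

Lemma qp : q1 * p = 1.
Proof. by rewrite -rmorphM divff // rmorph1. Qed.

Lemma pq : p * q1 = 1.
Proof. by rewrite -rmorphM mulVf // rmorph1. Qed.

Lemma qC x : x * q1 = q1 * x.
Proof. by rewrite f_central. Qed.

Lemma pC x : x * p = p * x.
Proof. by rewrite f_central. Qed.

(** Extracts an exchange rule from one entry; the scalar [u] is chosen so that the word on the left
    gets coefficient one. *)
Lemma reflection_rel u i b j c (x y : B) :
  x - y = u * ((\sum_k \sum_l RL_entry i b k l * RL_entry k l j c)
               - (\sum_k \sum_l LR_entry i b k l * LR_entry k l j c)) ->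
  x = y.
Proof. by rewrite -reflectionE reflection0 mxE mulr0 => /subr0_eq. Qed.

(** The rules [qp] and [pq] are tried first: otherwise [qC] and [pC] would swap the letters [q1] and
    [p] forever. *)
Ltac entry u i b j c :=
  apply: (@reflection_rel u i b j c);
  rewrite !sum_I3 /RL_entry /LR_entry /=; ncring (qp, pq, qC, pC).

(** * Exchange rules between the generators *)

Lemma ap_l1 : ap * l1 = q1 * q1 * l1 * ap.
Proof. entry (-1 : B) o1 o1 o2 o1. Qed.

Lemma l1_cp : l1 * cp = p * p * cp * l1.
Proof. entry (- p) o1 o1 o1 o3. Qed.

Lemma ap_cp : ap * cp = p * cp * ap.
Proof. entry (-1 : B) o1 o1 o2 o3. Qed.

Lemma cp_bp : cp * bp = q1 * bp * cp.
Proof. entry (- f q) o1 o2 o3 o3. Qed.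

Lemma l1_bp : l1 * bp = bp * l1.
Proof. entry (-1 : B) o1 o2 o1 o3. Qed.

Lemma l1_l2 : l1 * l2 = l2 * l1.
Proof. entry (-1 : B) o1 o2 o1 o2. Qed.

Lemma l1_l3 : l1 * l3 = l3 * l1.
Proof. entry (-1 : B) o1 o3 o1 o3. Qed.

Lemma l1_bm : l1 * bm = bm * l1.
Proof. entry (-1 : B) o1 o3 o1 o2. Qed.

Lemma l1_am : l1 * am = q1 * q1 * am * l1.
Proof. entry (- f q) o1 o2 o1 o1. Qed.

Lemma ap_am : ap * am = am * ap - h * l1 * (l1 - l2).
Proof. entry (- p) o1 o2 o2 o1. Qed.

Lemma ap_l2 : ap * l2 = l2 * ap - h * l1 * ap.
Proof. entry (-1 : B) o1 o2 o2 o2. Qed.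

Lemma ap_bp : ap * bp = p * bp * ap - h * l1 * cp.
Proof. entry (- p) o1 o2 o2 o3. Qed.

Lemma ap_cm : ap * cm = q1 * cm * ap + w * l1 * bm.
Proof. entry (-1 : B) o1 o3 o2 o1. Qed.

Lemma ap_bm : ap * bm = q1 * bm * ap.
Proof. entry (- f q) o1 o3 o2 o2. Qed.

Lemma ap_l3 : ap * l3 = l3 * ap.
Proof. entry (-1 : B) o1 o3 o2 o3. Qed.

Lemma cp_am : cp * am = q1 * am * cp + w * l1 * bp.
Proof. entry (-1 : B) o1 o2 o3 o1. Qed.

Lemma cp_cm : cp * cm = cm * cp - h * (ap * am + l1 * l1 - l1 * l3).
Proof. entry (- p) o1 o3 o3 o1. Qed.

Lemma cp_bm : cp * bm = p * bm * cp - h * (ap * l2 - ap * l3 + l1 * ap).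
Proof. entry (- p) o1 o3 o3 o2. Qed.

Lemma cp_l3 : cp * l3 = l3 * cp - h * (ap * bp + l1 * cp).
Proof. entry (-1 : B) o1 o3 o3 o3. Qed.

Lemma cp_l2 : cp * l2 = l2 * cp + w * bp * ap.
Proof. entry (1 : B) o2 o1 o2 o3. Qed.

Lemma l2_am : l2 * am = am * l2 - h * am * l1.
Proof. entry (1 : B) o2 o2 o1 o2. Qed.

Lemma l2_cm : l2 * cm = cm * l2 + w * am * bm.
Proof. entry (-1 : B) o2 o3 o2 o1. Qed.

Lemma l2_bm : l2 * bm = q1 * q1 * bm * l2 + q1 * w * cm * ap.
Proof. entry (- f q) o2 o3 o2 o2. Qed.

Lemma l2_l3 : l2 * l3 = l3 * l2.
Proof. entry (-1 : B) o2 o3 o2 o3. Qed.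

Lemma bp_am : bp * am = q1 * am * bp.
Proof. entry (f q) o2 o2 o1 o3. Qed.

Lemma bp_l2 : bp * l2 = q1 * q1 * l2 * bp + q1 * w * am * cp.
Proof. entry (f q) o2 o2 o2 o3. Qed.

Lemma bp_l3 : bp * l3 = l3 * bp - h * (am * cp + l2 * bp).
Proof. entry (-1 : B) o2 o3 o3 o3. Qed.

Lemma bp_cm : bp * cm = p * cm * bp - h * (am * l1 - am * l3 + l2 * am).
Proof. entry (- p) o2 o3 o3 o1. Qed.

Lemma bp_bm : bp * bm = bm * bp - h * (am * ap - cm * cp + l2 * l2 - l2 * l3).
Proof. entry (- p) o2 o3 o3 o2. Qed.

Lemma am_bm : am * bm = q1 * bm * am + w * cm * l1.
Proof. entry (-1 : B) o2 o3 o1 o2. Qed.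

Lemma am_l3 : am * l3 = l3 * am.
Proof. entry (-1 : B) o2 o3 o1 o3. Qed.

(** * Exchange rules for the inverse of [c^+] *)

Variable s : B.
Hypothesis cs : cp * s = 1.
Hypothesis sc : s * cp = 1.

(** Multiplying by [c^+] on both sides clears [s] and reduces a rule for [s] to the corresponding
    rule for [c^+]. *)
Lemma cp_conj_inj x y : cp * x * cp = cp * y * cp -> x = y.
Proof.
by move/(congr1 (fun z => s * z * s)); rewrite !mulrA sc !mul1r -!mulrA cs !mulr1.
Qed.

Lemma l1_s : l1 * s = q1 * q1 * s * l1.
Proof.
by apply: cp_conj_inj; ncring (qp, pq, qC, pC, cs, sc, l1_cp).
Qed.

Lemma ap_s : ap * s = q1 * s * ap.
Proof.
by apply: cp_conj_inj; ncring (qp, pq, qC, pC, cs, sc, ap_cp).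
Qed.

Lemma s_bp : s * bp = p * bp * s.
Proof.
by apply: cp_conj_inj; ncring (qp, pq, qC, pC, cs, sc, cp_bp).
Qed.

Lemma s_am : s * am = p * am * s - p * w * s * l1 * bp * s.
Proof.
by apply: cp_conj_inj; ncring (qp, pq, qC, pC, cs, sc, cp_am).
Qed.

Lemma s_l2 : s * l2 = l2 * s - w * s * bp * ap * s.
Proof.
by apply: cp_conj_inj; ncring (qp, pq, qC, pC, cs, sc, cp_l2).
Qed.

Lemma s_l3 : s * l3 = l3 * s + h * s * (ap * bp + l1 * cp) * s.
Proof.
by apply: cp_conj_inj; ncring (qp, pq, qC, pC, cs, sc, cp_l3).
Qed.

Lemma s_cm : s * cm = cm * s + h * s * (ap * am + l1 * l1 - l1 * l3) * s.
Proof.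
by apply: cp_conj_inj; ncring (qp, pq, qC, pC, cs, sc, cp_cm).
Qed.

Lemma s_bm : s * bm = q1 * bm * s + w * s * (ap * l2 - ap * l3 + l1 * ap) * s.
Proof.
by apply: cp_conj_inj; ncring (qp, pq, qC, pC, cs, sc, cp_bm).
Qed.

(* Every relation listed moves letters towards the order
   cm, bm, l3, am, l2, bp, (cp, s), l1, ap, so rewriting terminates. *)
Ltac rea := ncring (qp, pq, qC, pC, cs, sc,
    ap_l1, l1_cp, ap_cp, cp_bp, l1_bp, l1_l2, l1_l3, l1_bm, l1_am, ap_am,
    ap_l2, ap_bp, ap_cm, ap_bm, ap_l3, cp_am, cp_cm, cp_bm, cp_l3, cp_l2,
    l2_am, l2_cm, l2_bm, l2_l3, bp_am, bp_l2, bp_l3, bp_cm, bp_bm, am_bm,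
    am_l3, l1_s, ap_s, s_bp, s_am, s_l2, s_l3, s_cm, s_bm).

(** * Relations among the entries of the Schur complement *)

Local Notation d := (l2 - bp * s * ap).
Local Notation m := (am - bp * s * l1).
Local Notation n := (bm - l3 * s * ap).
Local Notation k := (cm - l3 * s * l1).

Lemma cp_d : cp * d = d * cp.
Proof. by rea. Qed.

Lemma s_d : s * d = d * s.
Proof. by rea. Qed.

Lemma ap_d : ap * d = d * ap.
Proof. by rea. Qed.

Lemma cp_m : cp * m = q1 * m * cp.
Proof. by rea. Qed.

Lemma cp_n : cp * n = p * n * cp - h * ap * d.
Proof. by rea. Qed.

Lemma cp_k : cp * k = k * cp - h * ap * m.
Proof. by rea. Qed.

Lemma m_d : m * d = d * m.
Proof. by rea. Qed.

Lemma d_n : d * n = q1 * q1 * n * d + q1 * w * d * d * s * ap.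
Proof. by rea. Qed.

Lemma d_k : d * k = k * d + q1 * w * n * m + q1 * w * d * s * ap * m.
Proof. by rea. Qed.

(** * Commutation of the quasi-determinants *)

Variable t : B.
Hypothesis dt : qdet2 L s * t = 1.
Hypothesis td : t * qdet2 L s = 1.

(** Eliminating [c^+] and then [d] computes the quasi-determinant as an iterated Schur complement;
    with the explicit block inverse both sides have the same free expansion. *)
Lemma qdet3E : qdet3 L = k - n * t * m.
Proof.
rewrite /qdet3 (ncinvmxP (qdet3_mx_inv cs sc dt td)) mul_row_block mul_row_col.
rewrite -!scalar_mxM -!raddfD -!scalar_mxM -raddfD mxE eqxx mulr1n.
by ncring qp.
Qed.

Lemma comm_t x : x * d = d * x -> x * t = t * x.
Proof. by move=> xd; apply: comm_inverse dt td _. Qed.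

Lemma qdet_commute :
  [/\ qdet1 L * qdet2 L s = qdet2 L s * qdet1 L,
      qdet1 L * qdet3 L = qdet3 L * qdet1 L
    & qdet2 L s * qdet3 L = qdet3 L * qdet2 L s].
Proof.
rewrite qdet3E /qdet1.
have := (comm_t s_d, comm_t ap_d, comm_t cp_d).
move: dt td cp_d cp_m cp_n cp_k m_d d_n d_k; rewrite /qdet2.
(* The four entries become opaque letters, so the final checks use only the relations among them. *)
move: d m n k => D M N K Dt tD cD cM cN cK mD dN dK [[sT apT] cT].
split=> //.
  ncring (qp, pq, qC, pC, Dt, tD, cD, cM, cN, cK, cT).
ncring (qp, pq, qC, pC, Dt, tD, cD, mD, dN, dK, sT, apT).
Qed.
End ReflectionEquation.

(** * The localized reflection equation algebra *)

Lemma reflection_comp (K A B : pzRingType) (f : {rmorphism K -> A})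
    (g : {rmorphism A -> B}) (M : 'M[K]_(3 * 3)) (L : 'M[A]_3) :
  reflection (map_mx f M) L = 0 -> reflection (map_mx (g \o f) M) (map_mx g L) = 0.
Proof. by rewrite map_mx_comp -map_reflection => ->; rewrite map_mx0. Qed.

Section ScalarsOfLocalization.
Variables (F : fieldType) (q : F).

Definition rea_scalar_rmorphism : {rmorphism F -> rea q} :=
  tquot_pi (rea_rel q) \o in_alg (free_rea F).

(** The localization is built as a bare ring; its scalars are recovered through this morphism with
    central image. *)
Definition loc_scalar : {rmorphism F -> rea_loc q} :=
  loc_map (schur q) \o (loc_map (reaL q o1 o3) \o rea_scalar_rmorphism).

Lemma loc_scalar_central c x : GRing.comm (loc_scalar c) x.
Proof.
apply: loc_map_central => y; apply: loc_map_central => z.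
exact: rea_scalar_central.
Qed.

Lemma loc_reflection : reflection (map_mx loc_scalar (drinfeldR q)) (locL q) = 0.
Proof.
apply: reflection_comp; apply: reflection_comp.
exact: rea_reflection.
Qed.
End ScalarsOfLocalization.

Lemma tnth3_commute (A : pzRingType) (x y z : A) :
    x * y = y * x -> x * z = z * x -> y * z = z * y ->
  forall i j : 'I_3, tnth [tuple x; y; z] i * tnth [tuple x; y; z] j
    = tnth [tuple x; y; z] j * tnth [tuple x; y; z] i.
Proof.
move=> xy xz yz [[|[|[|i]]] ?] [[|[|[|j]]] ?] //=;
  by rewrite !(tnth_nth 0) /= ?xy ?xz ?yz.
Qed.

Theorem theorem2p5 (R : realType) (q : R[i]) (hq : q != 0) :
  forall i j : 'I_3, qdet q i * qdet q j = qdet q j * qdet q i.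
Proof.
have [I12 I13 I23] := qdet_commute hq (@loc_scalar_central _ q) (loc_reflection q)
  (loc_cp_mulV q) (loc_cp_mulVl q) (loc_qdet2_mulV q) (loc_qdet2_mulVl q).
exact: tnth3_commute I12 I13 I23.
Qed.
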